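(* Let $G$ be an $n$-dimensional Lie group with a two-dimensional commutator subgroup, equipped with a left-invariant Riemannian metric $g=\langle\cdot,\cdot\rangle$, and let $\{u_i\}_{i=1}^{n-2}$ be an orthonormal basis of the $(n-2)$-dimensional subspace $\mathcal P$, so that $\{e_1,e_2,u_1,\dots,u_{n-2}\}$ is an orthonormal basis of $\mathfrak g$. Let $\mathrm{Ric}$ and $\widetilde{\mathrm{Ric}}$ be the Ricci tensors of $(G,g)$ and $(TG,\tilde g)$, and write $r(X)=\mathrm{Ric}(X,X)$, $\tilde r(A)=\widetilde{\mathrm{Ric}}(A,A)$. Then for all $u,v\in\mathcal P$: 1) $\tilde r(e_1^c)=r(e_1)-\frac12\left(3\|a_1\|^2+\|a_2\|^2\right)-\langle a_1,b_2\rangle$; 2) $\tilde r(e_2^c)=r(e_2)-\frac12\left(3\|b_2\|^2+\|b_1\|^2\right)-\langle a_1,b_2\rangle$; 3) $\tilde r(e_1^v)=2r(e_1)+\frac12\left(\|a_1\|^2+\|a_2\|^2\right)$; 4) $\tilde r(e_2^v)=2r(e_2)+\frac12\left(\|b_1\|^2+\|b_2\|^2\right)$; 5) $\tilde r(u^c)=2r(u)$; 6) $\tilde r(u^v)=r(u)+\frac12\left(\langle a_1,u\rangle^2+\langle b_2,u\rangle^2+2\langle a_2,u\rangle\langle b_1,u\rangle\right)$; 7) $\widetilde{\mathrm{Ric}}(e_1^c,e_2^c)=\mathrm{Ric}(e_1,e_2)-\frac12\left(\langle a_1,a_2+2b_1\rangle+\langle b_2,b_1+2a_2\rangle\right)$;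 8) $\widetilde{\mathrm{Ric}}(e_1^v,e_2^v)=2\mathrm{Ric}(e_1,e_2)+\frac12\left(\langle a_1,b_1\rangle+\langle a_2,b_2\rangle\right)$; 9) $\widetilde{\mathrm{Ric}}(u^c,v^c)=2\mathrm{Ric}(u,v)$; 10) $\widetilde{\mathrm{Ric}}(u^v,v^v)=\mathrm{Ric}(u,v)+\frac12\big(\langle a_1,u\rangle\langle a_1,v\rangle+\langle b_2,u\rangle\langle b_2,v\rangle+\langle b_1,u\rangle\langle a_2,v\rangle+\langle a_2,u\rangle\langle b_1,v\rangle\big)$; 11) $\widetilde{\mathrm{Ric}}(e_1^c,u^c)=2\mathrm{Ric}(e_1,u)$; 12) $\widetilde{\mathrm{Ric}}(e_2^c,u^c)=2\mathrm{Ric}(e_2,u)$; 13) $\widetilde{\mathrm{Ric}}(e_1^v,u^v)=\mathrm{Ric}(e_1,u)-\frac12\langle u,f_1(a_1+b_2)\rangle$; 14) $\widetilde{\mathrm{Ric}}(e_2^v,u^v)=\mathrm{Ric}(e_2,u)-\frac12\langle u,f_2(a_1+b_2)\rangle$; 15) $\widetilde{\mathrm{Ric}}(e_1^c,e_2^v)=\widetilde{\mathrm{Ric}}(e_1^c,e_1^v)=\widetilde{\mathrm{Ric}}(e_2^c,e_2^v)=\widetilde{\mathrm{Ric}}(e_1^v,e_2^c)=\widetilde{\mathrm{Ric}}(u^c,v^v)=\widetilde{\mathrm{Ric}}(u^c,u^v)=\widetilde{\mathrm{Ric}}(e_1^v,u^c)=\widetilde{\mathrm{Ric}}(e_2^v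,u^c)=\widetilde{\mathrm{Ric}}(e_1^c,u^v)=\widetilde{\mathrm{Ric}}(e_2^c,u^v)=0$.
   Context: $G$ is a connected $n$-dimensional real Lie group with Lie algebra $\mathfrak g$ (left-invariant vector fields) such that $\mathfrak g'=[\mathfrak g,\mathfrak g]$ has dimension $2$ (equivalently, the commutator subgroup is two-dimensional). $g$ is a left-invariant Riemannian metric on $G$, with induced inner product $\langle\cdot,\cdot\rangle$ on $\mathfrak g$ and $\|\cdot\|^2=\langle\cdot,\cdot\rangle$. $\{e_1,e_2\}$ is an orthonormal basis of $\mathfrak g'$ and $\mathcal P$ is the $(n-2)$-dimensional orthogonal complement of $\mathfrak g'$ in $\mathfrak g$. The vectors $a_1,a_2,b_1,b_2\in\mathcal P$ and skew-symmetric linear maps $f_1,f_2:\mathcal P\to\mathcal P$ are uniquely determined by: for all $u,v\in\mathcal P$, $[u,e_1]=\langle a_1,u\rangle e_1+\langle a_2,u\rangle e_2$, $[u,e_2]=\langle b_1,u\rangle e_1+\langle b_2,u\rangle e_2$, $[u,v]=\langle f_1(u),v\rangle e_1+\langle f_2(u),v\rangle e_2$. $TG$ is a Lie group with the tangent map $T\mu$ of the multiplication $\mu$ as product. For a vector field $X$ on $G$, the vertical lift $X^v$ is the infinitesimal generator on $TG$ of the flow $y\mapsto y+tX(x)$, $y\in T_xG$, and the complete lift $X^c$ is the infinitesimal generator of $T\phi_t$, where $\phi_t$ is the (local) flow of $X$. Lifts of left-invariant fields are left-invariant on $TG$, with $[X^c,Y^c]=[X,Y]^c$, $[X^c,Y^v]=[X,Y]^v$,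 $[X^v,Y^v]=0$. The lifted left-invariant metric $\tilde g$ on $TG$ is defined by $\tilde g(X^c,Y^c)=\tilde g(X^v,Y^v)=g(X,Y)$, $\tilde g(X^c,Y^v)=0$ for $X,Y\in\mathfrak g$. The Ricci tensor is $\mathrm{Ric}(Y,Z)=\sum_m g(R(E_m,Y)Z,E_m)$ over an orthonormal basis $(E_m)$, with $R(X,Y)Z=\nabla_X\nabla_YZ-\nabla_Y\nabla_XZ-\nabla_{[X,Y]}Z$ (unnormalized); similarly on $TG$. *)

(* Defs.v *)
From HB Require Import structures.
From mathcomp Require Import all_boot all_order all_algebra.
From mathcomp Require Import sesquilinear reals.

Set Implicit Arguments.
Unset Strict Implicit.
Unset Printing Implicit Defensive.

Import Order.TTheory GRing.Theory Num.Theory.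
Local Open Scope ring_scope.

(* A Lie group with a left-invariant Riemannian metric enters through its Lie  *)
(* algebra of left-invariant vector fields: a finite-dimensional real vector   *)
(* space V with a Lie bracket br and an inner product ip, i.e., a positive     *)
(* definite symmetric bilinear form {dot V for idfun}.                         *)

Section LieAlgebra.
Variables (R : realType) (V : vectType R).

Definition lie_bracket (br : V -> V -> V) : Prop :=
  (forall x, br x x = 0) /\
  (forall x y z, br x (br y z) + br y (br z x) + br z (br x y) = 0).

Definition derived_algebra (br : V -> V -> V) : {vspace V} :=
  <<[seq br x y | x <- vbasis {:V}, y <- vbasis {:V}]>>%VS.

Lemma mem_derived_algebra (br : {bilinear V -> V -> V}) (x y : V) :
  br x y \in derived_algebra br.
Proof.
rewrite (coord_vbasis (memvf x)) (coord_vbasis (memvf y)).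
rewrite linear_sumlz memv_suml // => i _; rewrite linear_sumr memv_suml // => j _.
rewrite linearZlr memvZ // memvZ // memv_span //.
by apply: allpairs_f; apply: mem_nth; rewrite size_tuple.
Qed.

Lemma derived_algebra_sub (br : V -> V -> V) (U : {vspace V}) :
  (forall x y, br x y \in U) -> (derived_algebra br <= U)%VS.
Proof.
by move=> brU; apply/span_subvP => z /allpairsP[[x y] [_ _ ->]]; apply: brU.
Qed.

Definition orthonormal_basis (ip : {dot V for idfun}) (U : {vspace V})
    (X : seq V) : Prop :=
  basis_of U X /\ orthonormal ip X.

(* On left-invariant fields ip Y Z is a constant function, so the derivative   *)
(* X (ip Y Z) in the metric condition vanishes; the Levi-Civita connection of  *)
(* a left-invariant metric sends left-invariant fields to left-invariant ones. *)
Definition levi_civita (br : V -> V -> V) (ip : V -> V -> R)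
    (nabla : {bilinear V -> V -> V}) : Prop :=
  (forall X Y, nabla X Y - nabla Y X = br X Y) /\
  (forall X Y Z, ip (nabla X Y) Z + ip Y (nabla X Z) = 0).

Definition curvature (br nabla : V -> V -> V) (X Y Z : V) : V :=
  nabla X (nabla Y Z) - nabla Y (nabla X Z) - nabla (br X Y) Z.

Definition ricci (br : V -> V -> V) (ip : V -> V -> R) (nabla : V -> V -> V)
    (E : seq V) (Y Z : V) : R :=
  \sum_(e <- E) ip (curvature br nabla e Y Z) e.

End LieAlgebra.

(* The Lie algebra of TG is spanned by the complete lifts X^c = (X, 0) and the *)
(* vertical lifts X^v = (0, X) of the left-invariant fields X of G, and        *)
(* A = (A.1, A.2) stands for A.1^c + A.2^v. The bracket is the bilinear        *)
(* extension of [X^c, Y^c] = [X, Y]^c, [X^c, Y^v] = [X, Y]^v, [X^v, Y^v] = 0;  *)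
(* the metric makes both lifts isometric with orthogonal ranges.               *)
Section TangentGroup.
Variables (R : realType) (V : vectType R).

Definition complete_lift (x : V) : V * V := (x, 0).
Definition vertical_lift (x : V) : V * V := (0, x).

Definition tangent_bracket (br : V -> V -> V) (A B : V * V) : V * V :=
  (br A.1 B.1, br A.1 B.2 + br A.2 B.1).

Definition tangent_metric (ip : V -> V -> R) (A B : V * V) : R :=
  ip A.1 B.1 + ip A.2 B.2.

Section Bracket.
Variable br : {bilinear V -> V -> V}.

Lemma tangent_bracket_bilinear :
  bilinear_for *:%R *:%R (tangent_bracket br).
Proof.
split=> [B|A] k X Y; rewrite /tangent_bracket /=.
  by congr pair; rewrite /= !linearPl // scalerDr addrACA.
by congr pair; rewrite /= !linearPr // scalerDr addrACA.
Qed.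

HB.instance Definition _ := bilinear_isBilinear.Build R (V * V)%type (V * V)%type
  (V * V)%type *:%R *:%R (tangent_bracket br) tangent_bracket_bilinear.

Lemma tangent_bracketcc (X Y : V) :
  tangent_bracket br (complete_lift X) (complete_lift Y) = complete_lift (br X Y).
Proof. by congr pair; rewrite /= linear0r linear0l addr0. Qed.

Lemma tangent_bracketcv (X Y : V) :
  tangent_bracket br (complete_lift X) (vertical_lift Y) = vertical_lift (br X Y).
Proof. by congr pair; rewrite /= ?linear0r ?linear0l ?addr0. Qed.

Lemma tangent_bracketvv (X Y : V) :
  tangent_bracket br (vertical_lift X) (vertical_lift Y) = 0.
Proof. by congr pair; rewrite /= ?linear0r ?linear0l ?addr0. Qed.

Lemma lie_bracketC : lie_bracket br -> forall x y, br x y = - br y x.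
Proof.
move=> [alt _] x y; apply/eqP; rewrite -addr_eq0; apply/eqP.
by have := alt (x + y); rewrite linearDl !linearDr !alt add0r addr0.
Qed.

Lemma tangent_lie_bracket : lie_bracket br -> lie_bracket (tangent_bracket br).
Proof.
move=> lie; have brC := lie_bracketC lie; case: lie => alt jac.
split=> [[x x']|[x x'] [y y'] [z z']]; rewrite /tangent_bracket /=.
  by rewrite alt (brC x' x) subrr.
congr pair => /=; first exact: jac.
rewrite !linearDr.
transitivity ((br x (br y z') + br y (br z' x) + br z' (br x y)) +
  (br x (br y' z) + br y' (br z x) + br z (br x y')) +
  (br x' (br y z) + br y (br z x') + br z (br x' y))); last first.
  by rewrite !jac !addr0.
by rewrite (AC (3*3*3) ((1*5*9)*(2*6*7)*(3*4*8))).
Qed.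

End Bracket.

Section Metric.
Variable ip : {dot V for idfun}.

Lemma tangent_metric_bilinear :
  bilinear_for *%R (idfun \; *%R) (tangent_metric ip).
Proof.
split=> [B|A] k X Y; rewrite /tangent_metric /=.
  by rewrite !linearPl /= mulrDr addrACA.
by rewrite !linearPr /= mulrDr addrACA.
Qed.

HB.instance Definition _ := bilinear_isBilinear.Build R (V * V)%type (V * V)%type
  R *%R (idfun \; *%R) (tangent_metric ip) tangent_metric_bilinear.

Lemma tangent_metric_sym (A B : V * V) :
  tangent_metric ip A B = (-1) ^+ false * idfun (tangent_metric ip B A).
Proof. by rewrite mul1r /tangent_metric; congr (_ + _); rewrite hermC mul1r. Qed.

HB.instance Definition _ := isHermitianSesquilinear.Build R (V * V)%type
  false idfun (tangent_metric ip) tangent_metric_sym.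

Lemma tangent_metric_gt0 (A : V * V) : A != 0 -> 0 < tangent_metric ip A A.
Proof.
case: A => x y A0.
have ge0 z : 0 <= ip z z.
  by have [->|/(neq0_dnorm_gt0 (s := ip))/ltW//] := eqVneq z 0; rewrite linear0l.
rewrite /tangent_metric /=; have [x0|x0] := eqVneq x 0; last first.
  by rewrite ltr_pwDl ?neq0_dnorm_gt0.
by rewrite ltr_wpDl ?neq0_dnorm_gt0 //; apply: contraNneq A0 => ->; rewrite x0.
Qed.

HB.instance Definition _ := isDotProduct.Build R (V * V)%type
  (tangent_metric ip) tangent_metric_gt0.

Lemma tangent_metriccc (X Y : V) :
  tangent_metric ip (complete_lift X) (complete_lift Y) = ip X Y.
Proof. by rewrite /tangent_metric /= linear0l addr0. Qed.

Lemma tangent_metricvv (X Y : V) :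
  tangent_metric ip (vertical_lift X) (vertical_lift Y) = ip X Y.
Proof. by rewrite /tangent_metric /= linear0l add0r. Qed.

Lemma tangent_metriccv (X Y : V) :
  tangent_metric ip (complete_lift X) (vertical_lift Y) = 0.
Proof. by rewrite /tangent_metric /= linear0l linear0r addr0. Qed.

End Metric.
End TangentGroup.

(* Main.v *)
From HB Require Import structures.
Require Import Defs.
From mathcomp Require Import all_boot all_order all_algebra.
From mathcomp Require Import sesquilinear reals.
From mathcomp Require Import ring lra.

Set Implicit Arguments.
Unset Strict Implicit.
Unset Printing Implicit Defensive.

Import Order.TTheory GRing.Theory Num.Theory.
Local Open Scope ring_scope.

(** Everything is read off one formula for the Ricci tensor of a left-invariant
    metric.  Write, over an orthonormal basis (e_i) of a metric Lie algebra,

      A(X, Y) = sum_i <[X, e_i], [Y, e_i]>,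
      K(X, Y) = tr (ad X ad Y),
      C(X, Y) = sum_{i,j} <[e_i, e_j], X> <[e_i, e_j], Y>,

    and let H be the vector with <H, X> = tr (ad X).  Then [ricci_formula]:

      Ric(X, Y) = C(X, Y) / 4 - (A(X, Y) + K(X, Y)) / 2
                  - (<[H, X], Y> + <[H, Y], X>) / 2.

    In the Lie algebra of TG, take the lifts of (e_i) as orthonormal basis.
    Since ad (X^c) acts by ad X on both kinds of lifts, while ad (X^v) sends Y^c
    to [X, Y]^v and kills vertical lifts, each ingredient of the formula is a
    multiple of its counterpart on G: on complete lifts A, K, C get the factors
    2, 2, 1, on vertical lifts 1, 0, 2, on mixed pairs all vanish, and H becomes
    2 H^c.  Hence, for every metric Lie algebra ([ricciT_cc], [ricciT_vv],
    [ricciT_cv], [ricciT_vc]),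

      Ric~(X^c, Y^c) = 2 Ric(X, Y) - C(X, Y) / 4,
      Ric~(X^v, Y^v) = 2 Ric(X, Y) + A(X, Y) / 2 + K(X, Y),
      Ric~(X^c, Y^v) = Ric~(X^v, Y^c) = 0.

    It remains to compute A, K, C and H when g' is a plane.  A Lie algebra acts
    with trace zero on itself through g', and this forces [e_1, e_2] = 0
    ([derived_abelian]), so that K(e_i, .) = 0 and the vectors a_1, a_2, b_1, b_2
    describe [x, e_1] and [x, e_2] for every x.  On the complement P of g', C
    vanishes because brackets lie in g'; and H = a_1 + b_2, the trace of the
    action on g'.

    The Ricci tensor and the forms above are traces.  To compute a trace, all one
    needs of an orthonormal basis is the expansion x = sum_i <x, e_i> e_i, so the
    sums run over families having this property ([parseval_frame]); the trace of
    an endomorphism does not depend on the family chosen, which allows passing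
    from arbitrary orthonormal bases to the adapted ones. *)

(** * Parseval frames *)

Section ParsevalFrame.
Variables (R : realType) (V : vectType R) (ip : {dot V for idfun}).

Lemma ipC x y : ip x y = ip y x.
Proof. by rewrite hermC mul1r. Qed.

Definition parseval_frame (E : seq V) : Prop :=
  forall x, x = \sum_(e <- E) ip x e *: e.

(** Induction on the basis: in k y + z with z in the span of the remaining
    vectors, orthogonality of y to that span identifies k. *)
Lemma orthonormal_expansion (U : {vspace V}) (X : seq V) :
  orthonormal_basis ip U X ->
  {in U, forall x, x = \sum_(e <- X) ip x e *: e}.
Proof.
case=> /andP[/eqP <- _] {U}; elim: X => [|y X IH] /=.
  by move=> _ x; rewrite span_nil memv0 big_nil => /eqP.
rewrite /orthonormal /= andbT => /andP[/andP[/eqP yy nX] /andP[/allP yX oX]] x.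
rewrite span_cons => /memv_addP[_ /vlineP[k ->] [z zX ->]].
have yperp e : e \in X -> ip y e = 0 by move=> /yX /eqP.
have {IH} zE := IH (introT andP (conj nX oX)) _ zX.
have zy : ip z y = 0.
  rewrite zE linear_sumlz big_seq big1 // => e eX.
  by rewrite linearZl_LR /= [ip e y]ipC yperp // mulr0.
rewrite big_cons linearDl linearZl_LR /= yy zy mulr1 addr0; congr (_ + _).
rewrite {1}zE !big_seq; apply: eq_bigr => e eX.
by rewrite linearDl linearZl_LR /= yperp // mulr0 add0r.
Qed.

Lemma parseval_identity (E : seq V) :
  parseval_frame E -> forall x y, ip x y = \sum_(e <- E) ip x e * ip y e.
Proof.
move=> frE x y; rewrite {1}(frE x) linear_sumlz.
by apply: eq_bigr => e _; rewrite linearZl_LR /= [ip e y]ipC.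
Qed.

Lemma trace_frame_indep (E E' : seq V) (F : {linear V -> V}) :
  parseval_frame E -> parseval_frame E' ->
  \sum_(e <- E) ip (F e) e = \sum_(e <- E') ip (F e) e.
Proof.
move=> frE frE'.
under eq_bigr do rewrite (parseval_identity frE').
rewrite exchange_big /=; apply: eq_bigr => f _.
rewrite [in F f](frE f) linear_sum linear_sumlz; apply: eq_bigr => e _.
by rewrite linearZ linearZl_LR /= mulrC ipC.
Qed.

End ParsevalFrame.

(** * The Ricci tensor of a left-invariant metric *)

Lemma antisym_sum0 (R : realType) (T : Type) (E : seq T) (d : T -> T -> R) :
  (forall e f, d e f = - d f e) -> \sum_(e <- E) \sum_(f <- E) d e f = 0.
Proof.
move=> dC; set S := LHS; suff: S = - S by lra.
rewrite /S {1}exchange_big /= -sumrN; apply: eq_bigr => e _.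
by rewrite -sumrN; apply: eq_bigr => f _; rewrite dC.
Qed.

Section Ricci.
Variables (R : realType) (V : vectType R).
Variables (br : {bilinear V -> V -> V}) (ip : {dot V for idfun}).

Definition ad_form (E : seq V) (X Y : V) : R :=
  \sum_(e <- E) ip (br X e) (br Y e).

Definition killing_form (E : seq V) (X Y : V) : R :=
  \sum_(e <- E) ip (br X (br Y e)) e.

Definition bracket_form (E : seq V) (X Y : V) : R :=
  \sum_(e <- E) \sum_(f <- E) ip (br e f) X * ip (br e f) Y.

Definition trace_ad (E : seq V) (X : V) : R := \sum_(e <- E) ip (br X e) e.

Definition represents_trace_ad (E : seq V) (H : V) : Prop :=
  forall X, ip H X = trace_ad E X.

Section Frame.
Variable E : seq V.
Hypothesis frE : parseval_frame ip E.

(** Matrix form of the trace of a product; its symmetry in the two factors is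
    the cyclicity of the trace. *)
Lemma killing_form_coord X Y :
  killing_form E X Y =
  \sum_(e <- E) \sum_(f <- E) ip (br X e) f * ip (br Y f) e.
Proof.
rewrite exchange_big /=; apply: eq_bigr => e _.
rewrite {1}(frE (br Y e)) linear_sumr linear_sumlz; apply: eq_bigr => f _.
by rewrite linearZr linearZl_LR /= mulrC.
Qed.

Lemma killing_formC X Y : killing_form E X Y = killing_form E Y X.
Proof.
rewrite !killing_form_coord exchange_big /=; apply: eq_bigr => e _.
by apply: eq_bigr => f _; rewrite mulrC.
Qed.

Lemma trace_ad_represented : exists H, represents_trace_ad E H.
Proof.
exists (\sum_(e <- E) trace_ad E e *: e) => X.
rewrite linear_sumlz {2}(frE X) /trace_ad.
under [RHS]eq_bigr do rewrite !linear_sumlz.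
rewrite exchange_big; apply: eq_bigr => e _.
rewrite linearZl_LR /= mulr_suml; apply: eq_bigr => f _.
by rewrite !linearZl_LR /= mulrC ipC.
Qed.

Hypothesis lie : lie_bracket br.

(** ad [X, Y] is the commutator of ad X and ad Y by the Jacobi identity. *)
Lemma trace_ad_bracket X Y : trace_ad E (br X Y) = 0.
Proof.
have brC := lie_bracketC lie.
have := subrr (killing_form E X Y); rewrite {2}killing_formC => <-.
rewrite /trace_ad /killing_form -sumrB; apply: eq_bigr => e _.
rewrite -linearBl; congr (ip _ _).
have := lie.2 X Y e; rewrite (brC e X) linearNr (brC e (br X Y)).
by move/eqP; rewrite subr_eq0 => /eqP ->.
Qed.

Variable nabla : {bilinear V -> V -> V}.
Hypothesis LC : levi_civita br ip nabla.

(** The metric is constant on left-invariant fields, so only the bracket terms of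
    the Koszul formula survive: metricity on the three cyclic permutations
    determines the connection. *)
Lemma koszul X Y Z :
  2 * ip (nabla X Y) Z = ip (br X Y) Z - ip (br Y Z) X + ip (br Z X) Y.
Proof.
case: LC => tor met.
rewrite -!tor !linearBl.
have := met X Y Z; have := met Y Z X; have := met Z X Y.
rewrite (ipC _ Z) (ipC _ X) (ipC _ Y); lra.
Qed.

Lemma linear_curvature Y Z : linear (fun X => curvature br nabla X Y Z).
Proof.
move=> k X X'; rewrite /curvature !(linearPl, linearPr) /=.
rewrite !scalerBr !opprD !addrA.
by rewrite (AC (6) (1*3*5*2*4*6)).
Qed.

Lemma ricci_frame_indep E' Y Z : parseval_frame ip E' ->
  ricci br ip nabla E Y Z = ricci br ip nabla E' Y Z.
Proof.
move=> frE'.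
pose m := GRing.isLinear.Build _ _ _ _ _ (linear_curvature Y Z).
pose F : {linear V -> V} := HB.pack (fun X => curvature br nabla X Y Z) m.
exact: (trace_frame_indep F frE frE').
Qed.

(** Summed over e, the term <nabla_e nabla_Y Z, e> is a divergence: it equals
    - tr ad (nabla_Y Z) = - <H, nabla_Y Z>, which gives the part of the formula
    with H.  The other two terms are expanded along a second index f; replacing
    nabla by its Koszul expression then produces the forms A, K and C plus an expression antisymmetric in (e, f), whose
    double sum vanishes. *)
Lemma ricci_formula H Y Z : represents_trace_ad E H ->
  ricci br ip nabla E Y Z =
    4^-1 * bracket_form E Y Z
    - 2^-1 * (ad_form E Y Z + killing_form E Y Z)
    - 2^-1 * (ip (br H Y) Z + ip (br H Z) Y).
Proof.
move=> HE; have brC := lie_bracketC lie; have [_ met] := LC.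
have divergence : 2 * ip H (nabla Y Z) = ip (br H Y) Z + ip (br H Z) Y.
  rewrite ipC koszul [ip _ H]ipC HE trace_ad_bracket (brC Z H) linearNl; lra.
pose z e f :=
  ip (nabla e Z) f * ip (nabla Y e) f + ip (br Y e) f * ip (nabla f Z) e.
have ricE : ricci br ip nabla E Y Z =
    - ip H (nabla Y Z) + \sum_(e <- E) \sum_(f <- E) z e f.
  rewrite HE /trace_ad -sumrN -big_split; apply: eq_bigr => e _ /=.
  rewrite big_split /= -(parseval_identity frE).
  have -> : \sum_(f <- E) ip (br Y e) f * ip (nabla f Z) e
            = ip (nabla (br Y e) Z) e.
    rewrite {2}(frE (br Y e)) !linear_sumlz; apply: eq_bigr => f _.
    by rewrite !linearZl_LR.
  rewrite /curvature !linearBl (brC e Y) linearNl /= linearNl opprK addrA.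
  congr (_ + _); congr (_ + _).
    have := met e (nabla Y Z) e; have := koszul e e (nabla Y Z).
    rewrite lie.1 linear0l (brC e) linearNl [ip (nabla Y Z) _]ipC; lra.
  have := met Y (nabla e Z) e; lra.
rewrite ricE /ad_form killing_form_coord.
have -> : \sum_(e <- E) ip (br Y e) (br Z e) =
    \sum_(e <- E) \sum_(f <- E) ip (br Y e) f * ip (br Z e) f.
  by apply: eq_bigr => e _; rewrite (parseval_identity frE).
apply/eqP; rewrite -subr_eq0; apply/eqP.
(* by divergence the terms with H cancel, leaving a single double sum *)
transitivity (\sum_(e <- E) \sum_(f <- E) (z e f
    - 4^-1 * (ip (br e f) Y * ip (br e f) Z)
    + 2^-1 * (ip (br Y e) f * ip (br Z e) f + ip (br Y e) f * ip (br Z f) e))).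
  have sumD (g h : V -> V -> R) : \sum_(e <- E) \sum_(f <- E) (g e f + h e f) =
      \sum_(e <- E) \sum_(f <- E) g e f + \sum_(e <- E) \sum_(f <- E) h e f.
    by rewrite -big_split; apply: eq_bigr => e _; rewrite big_split.
  have sumM k (g : V -> V -> R) : \sum_(e <- E) \sum_(f <- E) k * g e f =
      k * (\sum_(e <- E) \sum_(f <- E) g e f).
    by rewrite mulr_sumr; apply: eq_bigr => e _; rewrite mulr_sumr.
  have sumN (g : V -> V -> R) : \sum_(e <- E) \sum_(f <- E) - g e f =
      - (\sum_(e <- E) \sum_(f <- E) g e f).
    by rewrite -sumrN; apply: eq_bigr => e _; rewrite sumrN.
  (* an abstract z keeps its own sum from being split by sumD *)
  by clearbody z; rewrite sumD sumD sumN !sumM sumD /bracket_form; lra.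
apply: antisym_sum0 => e f.
have nablaE X1 X2 X3 : ip (nabla X1 X2) X3 =
    2^-1 * (ip (br X1 X2) X3 - ip (br X2 X3) X1 + ip (br X3 X1) X2).
  by rewrite -koszul; lra.
rewrite /z !nablaE (brC e Z) (brC f Z) (brC f e) (brC f Y) (brC e Y) !linearNl.
by field.
Qed.

End Frame.
End Ricci.

(** * The Ricci tensor of the tangent group *)

Section TangentRicci.
Variables (R : realType) (V : vectType R).
Variables (br : {bilinear V -> V -> V}) (ip : {dot V for idfun}).
Variable E : seq V.
Hypothesis frE : parseval_frame ip E.

Local Notation c := (@complete_lift R V).
Local Notation w := (@vertical_lift R V).
Local Notation tbr := (tangent_bracket br).
Local Notation tip := (tangent_metric ip).

Definition lifted_frame : seq (V * V) := map c E ++ map w E.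
Local Notation ET := lifted_frame.

Lemma sum_lifted_frame (A : zmodType) (F : V * V -> A) :
  \sum_(e <- ET) F e = \sum_(e <- E) F (c e) + \sum_(e <- E) F (w e).
Proof. by rewrite big_cat !big_map. Qed.

Lemma parseval_lifted_frame : parseval_frame tip ET.
Proof.
have cD : {morph c : x y / x + y} by move=> x y; congr pair; rewrite /= addr0.
have wD : {morph w : x y / x + y} by move=> x y; congr pair; rewrite /= addr0.
case=> x y; transitivity (c x + w y); first by congr pair; rewrite /= ?addr0 ?add0r.
rewrite sum_lifted_frame [in LHS](frE x) [in LHS](frE y).
rewrite (big_morph c cD erefl) (big_morph w wD erefl).
congr (_ + _); apply: eq_bigr => e _;
  rewrite /= /tangent_metric /= linear0r ?addr0 ?add0r.
  by congr pair; rewrite /= scaler0.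
by congr pair; rewrite /= scaler0.
Qed.

Lemma tangent_bracketvc (X Y : V) : tbr (w X) (c Y) = w (br X Y).
Proof. by congr pair; rewrite /= ?linear0r ?linear0l ?add0r. Qed.

Lemma tangent_metricvc (X Y : V) : tip (w X) (c Y) = 0.
Proof. by rewrite /tangent_metric /= linear0l linear0r addr0. Qed.

Definition lift_simp := (tangent_bracketcc, tangent_bracketcv, tangent_bracketvc,
  tangent_bracketvv, tangent_metriccc, tangent_metriccv, tangent_metricvc,
  tangent_metricvv, linear0l, linear0r).

Lemma ad_form_cc X Y : ad_form tbr tip ET (c X) (c Y) = 2 * ad_form br ip E X Y.
Proof.
rewrite /ad_form sum_lifted_frame mulr2n mulrDl !mul1r.
by congr (_ + _); apply: eq_bigr => e _; rewrite /= !lift_simp.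
Qed.

Lemma ad_form_vv X Y : ad_form tbr tip ET (w X) (w Y) = ad_form br ip E X Y.
Proof.
rewrite /ad_form sum_lifted_frame [X in _ + X]big1 ?addr0.
  by apply: eq_bigr => e _; rewrite /= !lift_simp.
by move=> e _; rewrite /= !lift_simp.
Qed.

Lemma ad_form_cv X Y : ad_form tbr tip ET (c X) (w Y) = 0.
Proof.
by rewrite /ad_form sum_lifted_frame !big1 ?addr0 // => e _; rewrite /= !lift_simp.
Qed.

Lemma killing_form_cc X Y :
  killing_form tbr tip ET (c X) (c Y) = 2 * killing_form br ip E X Y.
Proof.
rewrite /killing_form sum_lifted_frame mulr2n mulrDl !mul1r.
by congr (_ + _); apply: eq_bigr => e _; rewrite /= !lift_simp.
Qed.

(** ad (Y^v) takes its values in the vertical lifts and kills them, and ad A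
    preserves them, so the product of the two is nilpotent. *)
Lemma killing_form_v A Y : killing_form tbr tip ET A (w Y) = 0.
Proof.
rewrite /killing_form sum_lifted_frame !big1 ?addr0 // => e _;
  by rewrite /= /tangent_bracket /tangent_metric /= !(linear0l, linear0r, add0r, addr0).
Qed.

Lemma bracket_form_cc X Y :
  bracket_form tbr tip ET (c X) (c Y) = bracket_form br ip E X Y.
Proof.
rewrite /bracket_form sum_lifted_frame [X in _ + X]big1 ?addr0.
  apply: eq_bigr => e _; rewrite sum_lifted_frame [X in _ + X]big1 ?addr0.
    by apply: eq_bigr => f _; rewrite /= !lift_simp.
  by move=> f _; rewrite /= !lift_simp mul0r.
by move=> e _; rewrite sum_lifted_frame !big1 ?addr0 // => f _;
  rewrite /= !lift_simp mul0r.
Qed.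

Lemma bracket_form_vv X Y :
  bracket_form tbr tip ET (w X) (w Y) = 2 * bracket_form br ip E X Y.
Proof.
rewrite /bracket_form sum_lifted_frame mulr2n mulrDl !mul1r.
congr (_ + _); apply: eq_bigr => e _; rewrite sum_lifted_frame.
  rewrite big1 ?add0r => [|f _]; last by rewrite /= !lift_simp mul0r.
  by apply: eq_bigr => f _; rewrite /= !lift_simp.
rewrite [X in _ + X]big1 ?addr0 => [|f _]; last by rewrite /= !lift_simp mul0r.
by apply: eq_bigr => f _; rewrite /= !lift_simp.
Qed.

Lemma bracket_form_cv X Y : bracket_form tbr tip ET (c X) (w Y) = 0.
Proof.
rewrite /bracket_form sum_lifted_frame !big1 ?addr0 // => e _;
  by rewrite sum_lifted_frame !big1 ?addr0 // => f _; rewrite /= !lift_simp ?mulr0 ?mul0r.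
Qed.

Lemma represents_trace_ad_lift H :
  represents_trace_ad br ip E H -> represents_trace_ad tbr tip ET (2 *: c H).
Proof.
move=> HE [X X']; rewrite linearZl_LR /= /tangent_metric /= linear0l addr0 HE.
rewrite /trace_ad sum_lifted_frame mulr2n mulrDl !mul1r.
congr (_ + _); apply: eq_bigr => e _;
  by rewrite /= /tangent_bracket /tangent_metric /= !(linear0l, linear0r, add0r, addr0).
Qed.

Hypothesis lie : lie_bracket br.
Variable nabla : {bilinear V -> V -> V}.
Hypothesis LC : levi_civita br ip nabla.
Variable nablaT : {bilinear (V * V)%type -> (V * V)%type -> (V * V)%type}.
Hypothesis LCT : levi_civita tbr tip nablaT.
Variable FT : seq (V * V).
Hypothesis frFT : parseval_frame tip FT.

Local Notation Ric := (ricci br ip nabla E).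
Local Notation RicT := (ricci tbr tip nablaT FT).

(** The lifted frame has trace vector 2 H^c; the factor 2 cancels the 1/2 in front
    of the last term of the formula. *)
Lemma ricciT_lifted_formula H A B : represents_trace_ad br ip E H ->
  RicT A B = 4^-1 * bracket_form tbr tip ET A B
    - 2^-1 * (ad_form tbr tip ET A B + killing_form tbr tip ET A B)
    - (tip (tbr (c H) A) B + tip (tbr (c H) B) A).
Proof.
move=> /represents_trace_ad_lift HT.
rewrite (ricci_frame_indep tbr frFT nablaT A B parseval_lifted_frame).
rewrite (ricci_formula parseval_lifted_frame (tangent_lie_bracket lie) LCT _ _ HT).
by rewrite !linearZl_LR /=; lra.
Qed.

Lemma ricciT_cc X Y :
  RicT (c X) (c Y) = 2 * Ric X Y - 4^-1 * bracket_form br ip E X Y.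
Proof.
have [H HE] := trace_ad_represented br frE.
rewrite (ricciT_lifted_formula _ _ HE) (ricci_formula frE lie LC _ _ HE).
by rewrite bracket_form_cc ad_form_cc killing_form_cc !lift_simp; lra.
Qed.

Lemma ricciT_vv X Y :
  RicT (w X) (w Y) = 2 * Ric X Y + 2^-1 * ad_form br ip E X Y + killing_form br ip E X Y.
Proof.
have [H HE] := trace_ad_represented br frE.
rewrite (ricciT_lifted_formula _ _ HE) (ricci_formula frE lie LC _ _ HE).
by rewrite bracket_form_vv ad_form_vv killing_form_v !lift_simp; lra.
Qed.

Lemma ricciT_cv X Y : RicT (c X) (w Y) = 0.
Proof.
have [H HE] := trace_ad_represented br frE.
rewrite (ricciT_lifted_formula _ _ HE) bracket_form_cv ad_form_cv killing_form_v.
by rewrite /= !lift_simp; lra.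
Qed.

Lemma ricciT_vc X Y : RicT (w X) (c Y) = 0.
Proof.
have [H HE] := trace_ad_represented br frE.
rewrite -(ricciT_cv Y X) !(ricciT_lifted_formula _ _ HE).
have -> : ad_form tbr tip ET (w X) (c Y) = ad_form tbr tip ET (c Y) (w X).
  by apply: eq_bigr => e _; rewrite ipC.
have -> : bracket_form tbr tip ET (w X) (c Y) = bracket_form tbr tip ET (c Y) (w X).
  by apply: eq_bigr => e _; apply: eq_bigr => f _; rewrite mulrC.
by rewrite (killing_formC tbr parseval_lifted_frame) [X in _ - X = _]addrC.
Qed.

End TangentRicci.

(** * Metric Lie algebras with a two-dimensional derived algebra *)

Section DerivedComplement.
Variables (R : realType) (V : vectType R).
Variables (br : {bilinear V -> V -> V}) (ip : {dot V for idfun}).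

Lemma ip_bracket_complement x y u :
  u \in orthov ip (derived_algebra br) -> ip (br x y) u = 0.
Proof. by move=> /mem_orthovP uP; rewrite ipC uP // mem_derived_algebra. Qed.

Lemma bracket_form_complement E x u :
  u \in orthov ip (derived_algebra br) -> bracket_form br ip E x u = 0.
Proof.
move=> uP; rewrite /bracket_form big1 // => e _; rewrite big1 // => f _.
by rewrite [ip _ u]ip_bracket_complement ?mulr0.
Qed.

End DerivedComplement.

Section TwoDimensionalDerivedAlgebra.
Variables (R : realType) (V : vectType R).
Variables (br : {bilinear V -> V -> V}) (ip : {dot V for idfun}).
Hypothesis lie : lie_bracket br.
Local Notation D := (derived_algebra br).
Local Notation P := (orthov ip D).
Variables e1 e2 : V.
Hypothesis onD : orthonormal_basis ip D [:: e1; e2].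
Variable us : seq V.
Hypothesis onP : orthonormal_basis ip P us.

Local Notation E := [:: e1, e2 & us].

Lemma adapted_basis_in_D : e1 \in D /\ e2 \in D.
Proof.
by case: onD => onb _; split; apply: (basis_mem onb); rewrite !inE eqxx ?orbT.
Qed.

Lemma adapted_basis_ip :
  [/\ ip e1 e1 = 1, ip e2 e2 = 1, ip e1 e2 = 0 & ip e2 e1 = 0].
Proof.
case: onD => _; rewrite /orthonormal /= !andbT.
by case/andP=> /andP[/eqP -> /eqP ->] /eqP o12; rewrite (ipC ip e2) o12.
Qed.

Lemma derived_expansion x : x \in D -> x = ip x e1 *: e1 + ip x e2 *: e2.
Proof. by move/(orthonormal_expansion onD); rewrite !big_cons big_nil addr0. Qed.

Lemma ip_complement x y : x \in P -> y \in D -> ip x y = 0.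
Proof. by move/mem_orthovP; apply. Qed.

Lemma parseval_adapted_basis : parseval_frame ip E.
Proof.
move=> x; rewrite !big_cons addrA.
have [i11 i22 i12 i21] := adapted_basis_ip.
pose y := x - (ip x e1 *: e1 + ip x e2 *: e2).
have yP : y \in P.
  apply/mem_orthovP => z /derived_expansion ->.
  rewrite /y linearBl linearDl !linearDr !linearZl_LR !linearZr /=.
  by rewrite i11 i12 i21 i22; ring.
rewrite -[LHS](subrK (ip x e1 *: e1 + ip x e2 *: e2)) -/y addrC; congr (_ + _).
rewrite [LHS](orthonormal_expansion onP yP) !big_seq; apply: eq_bigr => u uus.
have uP : u \in P by apply: basis_mem uus; case: onP.
have [e1D e2D] := adapted_basis_in_D.
rewrite linearBl linearDl !linearZl_LR /= [ip e1 u]ipC [ip e2 u]ipC.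
by rewrite (ip_complement uP e1D) (ip_complement uP e2D) !mulr0 addr0 subr0.
Qed.
Local Notation frE := parseval_adapted_basis.

Lemma trace_adapted_basis (F : V -> V) : (forall x, F x \in D) ->
  \sum_(e <- E) ip (F e) e = ip (F e1) e1 + ip (F e2) e2.
Proof.
move=> FD; rewrite !big_cons big_seq big1 ?addr0 // => u uus.
by rewrite ipC ip_complement //; apply: basis_mem uus; case: onP.
Qed.

(** The vectors where the linear form tr ad vanishes form a subspace, namely the
    orthogonal complement of H, and it contains all brackets. *)
Lemma trace_ad_derived x : x \in D -> trace_ad br ip E x = 0.
Proof.
have [H HE] := trace_ad_represented br frE; rewrite -HE => xD; apply/eqP.
rewrite ipC -mem_orthov1; move: x xD; apply/subvP/derived_algebra_sub => y z.
by rewrite mem_orthov1 /= ipC HE (trace_ad_bracket frE lie).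
Qed.

(** Brackets have no component in P, so tr ad (e_1) = <[e_1, e_2], e_2> and
    tr ad (e_2) = - <[e_1, e_2], e_1>; both traces vanish, hence so does
    [e_1, e_2]. *)
Lemma derived_abelian : {in D &, forall x y, br x y = 0}.
Proof.
have [e1D e2D] := adapted_basis_in_D.
have brC := lie_bracketC lie.
have tr x : trace_ad br ip E x = ip (br x e1) e1 + ip (br x e2) e2.
  by apply: trace_adapted_basis => y; apply: mem_derived_algebra.
have br12 : br e1 e2 = 0.
  rewrite (derived_expansion (mem_derived_algebra br e1 e2)).
  have := trace_ad_derived e1D; have := trace_ad_derived e2D.
  rewrite !tr !lie.1 !linear0l addr0 add0r (brC e2) linearNl => /eqP.
  by rewrite oppr_eq0 => /eqP -> ->; rewrite !scale0r addr0.
move=> x y /derived_expansion -> /derived_expansion ->.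
rewrite !(linearDl, linearDr) !linearZl_LR !linearZr /= !lie.1 (brC e2 e1) br12.
by rewrite oppr0 !scaler0 !addr0.
Qed.

Variables a1 a2 b1 b2 : V.
Hypotheses (a1P : a1 \in P) (a2P : a2 \in P) (b1P : b1 \in P) (b2P : b2 \in P).
Hypothesis br1P : {in P, forall u, br u e1 = ip a1 u *: e1 + ip a2 u *: e2}.
Hypothesis br2P : {in P, forall u, br u e2 = ip b1 u *: e1 + ip b2 u *: e2}.

Lemma split_derived x : exists2 d, d \in D & exists2 p, p \in P & x = d + p.
Proof.
have [e1D e2D] := adapted_basis_in_D.
exists (ip x e1 *: e1 + ip x e2 *: e2); first by rewrite memvD ?memvZ.
exists (\sum_(u <- us) ip x u *: u); last first.
  by rewrite {1}(frE x) !big_cons addrA.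
rewrite big_seq memv_suml // => u uus; rewrite memvZ //.
by apply: basis_mem uus; case: onP.
Qed.

(** Both sides vanish for x in g', so the defining property of a_1 and a_2 on P
    holds on the whole Lie algebra; this is what makes the sums over the adapted
    basis below uniform in the basis vector. *)
Lemma bracket_e1 x : br x e1 = ip a1 x *: e1 + ip a2 x *: e2.
Proof.
have [d dD [p pP ->]] := split_derived x; have [e1D e2D] := adapted_basis_in_D.
rewrite linearDl derived_abelian // br1P // !linearDr /=.
by rewrite (ip_complement a1P dD) (ip_complement a2P dD) !add0r.
Qed.

Lemma bracket_e2 x : br x e2 = ip b1 x *: e1 + ip b2 x *: e2.
Proof.
have [d dD [p pP ->]] := split_derived x; have [e1D e2D] := adapted_basis_in_D.
rewrite linearDl derived_abelian // br2P // !linearDr /=.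
by rewrite (ip_complement b1P dD) (ip_complement b2P dD) !add0r.
Qed.

Lemma represents_trace_ad_adapted : represents_trace_ad br ip E (a1 + b2).
Proof.
have [i11 i22 i12 i21] := adapted_basis_ip.
move=> x; rewrite /trace_ad trace_adapted_basis => [|y]; last first.
  exact: mem_derived_algebra.
rewrite bracket_e1 bracket_e2 !linearDl !linearZl_LR /= i11 i22 i12 i21; ring.
Qed.

(** Each component of ad e along the basis of g' is a linear form x |-> - <x_i, x>,
    so the Parseval identity sums the products of these components. *)
Lemma ad_form_derived (e e' x1 x2 y1 y2 : V) :
  (forall z, br z e = ip x1 z *: e1 + ip x2 z *: e2) ->
  (forall z, br z e' = ip y1 z *: e1 + ip y2 z *: e2) ->
  ad_form br ip E e e' = ip x1 y1 + ip x2 y2.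
Proof.
have [i11 i22 i12 i21] := adapted_basis_ip.
move=> bre bre'; rewrite !(parseval_identity frE) -big_split; apply: eq_bigr => z _.
rewrite (lie_bracketC lie e) (lie_bracketC lie e') bre bre' linearNl linearNr /= opprK.
rewrite !(linearDl, linearDr) !linearZl_LR !linearZr /= i11 i22 i12 i21; ring.
Qed.

Lemma killing_form_derived x y : x \in D -> killing_form br ip E x y = 0.
Proof.
move=> xD; rewrite /killing_form big1 // => e _.
by rewrite derived_abelian ?linear0l // mem_derived_algebra.
Qed.

(** The trace of the product of the 2 by 2 matrices by which x and y act on g'. *)
Lemma killing_form_adapted x y :
  killing_form br ip E x y = ip a1 x * ip a1 y + ip b2 x * ip b2 y
                             + ip b1 x * ip a2 y + ip a2 x * ip b1 y.
Proof.
have [i11 i22 i12 i21] := adapted_basis_ip.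
rewrite /killing_form (trace_adapted_basis (F := fun e => br x (br y e))); last first.
  by move=> e; apply: mem_derived_algebra.
rewrite bracket_e1 bracket_e2 !linearDr !linearZr /= bracket_e1 bracket_e2.
rewrite !linearDl !linearZl_LR /= !linearDl !linearZl_LR /= i11 i22 i12 i21; ring.
Qed.

End TwoDimensionalDerivedAlgebra.

Theorem theorem3p4 (R : realType) (n : nat) (V : vectType R)
    (br : {bilinear V -> V -> V}) (ip : {dot V for idfun})
    (hlie : lie_bracket br)
    (hdim : \dim {:V} = n)
    (hder : \dim (derived_algebra br) = 2%N)
    (e1 e2 : V)
    (he : orthonormal_basis ip (derived_algebra br) [:: e1; e2])
    (P : {vspace V})
    (hP : P = orthov ip (derived_algebra br))
    (us : (n - 2).-tuple V)
    (hus : orthonormal_basis ip P us)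
    (a1 a2 b1 b2 : V)
    (ha1 : a1 \in P) (ha2 : a2 \in P) (hb1 : b1 \in P) (hb2 : b2 \in P)
    (f1 f2 : 'End(V))
    (hf1P : {in P, forall u, f1 u \in P})
    (hf2P : {in P, forall u, f2 u \in P})
    (hf1skew : {in P &, forall u v, ip (f1 u) v = - ip u (f1 v)})
    (hf2skew : {in P &, forall u v, ip (f2 u) v = - ip u (f2 v)})
    (hbr1 : {in P, forall u, br u e1 = ip a1 u *: e1 + ip a2 u *: e2})
    (hbr2 : {in P, forall u, br u e2 = ip b1 u *: e1 + ip b2 u *: e2})
    (hbrP : {in P &, forall u v, br u v = ip (f1 u) v *: e1 + ip (f2 u) v *: e2})
    (nabla : {bilinear V -> V -> V})
    (hnabla : levi_civita br ip nabla)
    (E : seq V)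
    (hE : orthonormal_basis ip fullv E)
    (nablaT : {bilinear (V * V)%type -> (V * V)%type -> (V * V)%type})
    (hnablaT : levi_civita (tangent_bracket br) (tangent_metric ip) nablaT)
    (ET : seq (V * V))
    (hET : orthonormal_basis (tangent_metric ip) fullv ET) :
  let Ric := ricci br ip nabla E in
  let RicT := ricci (tangent_bracket br) (tangent_metric ip) nablaT ET in
  let r x := Ric x x in
  let rT A := RicT A A in
  let c := @complete_lift R V in
  let w := @vertical_lift R V in
  forall u v : V, u \in P -> v \in P ->
  (* 1 *) rT (c e1) = r e1 - 2^-1 * (3 * ip a1 a1 + ip a2 a2) - ip a1 b2 /\
  (* 2 *) rT (c e2) = r e2 - 2^-1 * (3 * ip b2 b2 + ip b1 b1) - ip a1 b2 /\
  (* 3 *) rT (w e1) = 2 * r e1 + 2^-1 * (ip a1 a1 + ip a2 a2) /\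
  (* 4 *) rT (w e2) = 2 * r e2 + 2^-1 * (ip b1 b1 + ip b2 b2) /\
  (* 5 *) rT (c u) = 2 * r u /\
  (* 6 *) rT (w u) = r u + 2^-1 * (ip a1 u ^+ 2 + ip b2 u ^+ 2
                                   + 2 * ip a2 u * ip b1 u) /\
  (* 7 *) RicT (c e1) (c e2) = Ric e1 e2
            - 2^-1 * (ip a1 (a2 + 2 *: b1) + ip b2 (b1 + 2 *: a2)) /\
  (* 8 *) RicT (w e1) (w e2) = 2 * Ric e1 e2 + 2^-1 * (ip a1 b1 + ip a2 b2) /\
  (* 9 *) RicT (c u) (c v) = 2 * Ric u v /\
  (* 10 *) RicT (w u) (w v) = Ric u v
            + 2^-1 * (ip a1 u * ip a1 v + ip b2 u * ip b2 v
                      + ip b1 u * ip a2 v + ip a2 u * ip b1 v) /\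
  (* 11 *) RicT (c e1) (c u) = 2 * Ric e1 u /\
  (* 12 *) RicT (c e2) (c u) = 2 * Ric e2 u /\
  (* 13 *) RicT (w e1) (w u) = Ric e1 u - 2^-1 * ip u (f1 (a1 + b2)) /\
  (* 14 *) RicT (w e2) (w u) = Ric e2 u - 2^-1 * ip u (f2 (a1 + b2)) /\
  (* 15 *) (RicT (c e1) (w e2) = 0 /\ RicT (c e1) (w e1) = 0 /\
            RicT (c e2) (w e2) = 0 /\ RicT (w e1) (c e2) = 0 /\
            RicT (c u) (w v) = 0 /\ RicT (c u) (w u) = 0 /\
            RicT (w e1) (c u) = 0 /\ RicT (w e2) (c u) = 0 /\
            RicT (c e1) (w u) = 0 /\ RicT (c e2) (w u) = 0).
Proof.
subst P; move=> Ric RicT r rT c w u v uP vP.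
have [e1D e2D] := adapted_basis_in_D he.
have [i11 i22 i12 i21] := adapted_basis_ip he.
have frA : parseval_frame ip [:: e1, e2 & us] := parseval_adapted_basis he hus.
have frE : parseval_frame ip E.
  by move=> x; apply: (orthonormal_expansion hE); apply: memvf.
have frET : parseval_frame (tangent_metric ip) ET.
  by move=> x; apply: (orthonormal_expansion hET); apply: memvf.
have be1 := bracket_e1 hlie he hus ha1 ha2 hbr1.
have be2 := bracket_e2 hlie he hus hb1 hb2 hbr2.
have HP : a1 + b2 \in orthov ip (derived_algebra br) by rewrite memvD.
have trH := represents_trace_ad_adapted hlie he hus ha1 ha2 hb1 hb2 hbr1 hbr2.
have RicE x y : Ric x y = ricci br ip nabla [:: e1, e2 & us] x y.
  exact: ricci_frame_indep.
have RicF x y := ricci_formula frA hlie hnabla x y trH.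
have Rcc x y := ricciT_cc frA hlie hnabla hnablaT frET x y.
have Rvv x y := ricciT_vv frA hlie hnabla hnablaT frET x y.
have Rcv x y := ricciT_cv frA hlie hnablaT frET x y.
have Rvc x y := ricciT_vc frA hlie hnablaT frET x y.
have A11 := ad_form_derived hlie he hus be1 be1.
have A12 := ad_form_derived hlie he hus be1 be2.
have A22 := ad_form_derived hlie he hus be2 be2.
have K1 y := killing_form_derived hlie he hus y e1D.
have K2 y := killing_form_derived hlie he hus y e2D.
have Kad := killing_form_adapted hlie he hus ha1 ha2 hb1 hb2 hbr1 hbr2.
have ip_e x y : (ip (x *: e1 + y *: e2) e1 = x) * (ip (x *: e1 + y *: e2) e2 = y).
  rewrite !linearDl !linearZl_LR /= i11 i22 i12 i21.
  by rewrite !mulr1 !mulr0 addr0 add0r.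
have cc_P x y : y \in orthov ip (derived_algebra br) ->
    RicT (c x) (c y) = 2 * Ric x y.
  by move=> yP; rewrite /RicT Rcc RicE bracket_form_complement // mulr0 subr0.
(* on P the terms with H vanish, as [H, x] lies in the derived algebra *)
have ww_P x y : x \in orthov ip (derived_algebra br) ->
    y \in orthov ip (derived_algebra br) -> RicT (w x) (w y) = Ric x y
    + 2^-1 * (ip a1 x * ip a1 y + ip b2 x * ip b2 y
              + ip b1 x * ip a2 y + ip a2 x * ip b1 y).
  move=> xP yP; rewrite /RicT Rvv RicE RicF bracket_form_complement // Kad.
  by rewrite !ip_bracket_complement //; lra.
(* C, K and <[H, x], y> vanish here, so Ric = - A / 2 - <[H, y], x> / 2, and
   2 Ric + A / 2 is again Ric up to the term with H *)
have ww_DP x y : x \in derived_algebra br ->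
    y \in orthov ip (derived_algebra br) ->
    RicT (w x) (w y) = Ric x y - 2^-1 * ip (br (a1 + b2) y) x.
  move=> xD yP; rewrite /RicT Rvv RicE RicF bracket_form_complement //.
  rewrite (killing_form_derived hlie he hus y xD).
  by rewrite [ip _ y]ip_bracket_complement //; lra.
split.
  by rewrite /rT /r /RicT Rcc RicE RicF A11 K1 be1 !ip_e linearDr /=; lra.
split.
  rewrite /rT /r /RicT Rcc RicE RicF A22 K2 be2 !ip_e.
  rewrite !linearDr /= [ip b2 a1]ipC; lra.
split; first by rewrite /rT /r /RicT Rvv RicE A11 K1 addr0.
split; first by rewrite /rT /r /RicT Rvv RicE A22 K2 addr0.
split; first exact: cc_P.
split; first by rewrite /rT ww_P // /r; congr (_ + _); ring.
split.
  rewrite /RicT Rcc RicE RicF A12 K1 be1 be2 !ip_e.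
  rewrite !linearDr !linearZr /= [ip b1 a1]ipC [ip b1 b2]ipC.
  by rewrite [ip a2 a1]ipC [ip a2 b2]ipC; lra.
split; first by rewrite /RicT Rvv RicE A12 K1 addr0.
split; first exact: cc_P.
split; first exact: ww_P.
split; first exact: cc_P.
split; first exact: cc_P.
split; first by rewrite ww_DP // hbrP // ip_e ipC.
split; first by rewrite ww_DP // hbrP // ip_e ipC.
by rewrite /RicT !Rcv !Rvc.
Qed.
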